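(* For all positive integers $k$ and $r$, except possibly finitely many integers $r$ for each odd $k$, we have $R_{\mathrm{list}}(K_{1,r},k)=R(K_{1,r},k)$. (In particular, for even $k$ no exceptional $r$ is allowed.) More precisely: (a) For all positive integers $r,k$ we have $(r-1)k+1\le R_{\mathrm{list}}(K_{1,r},k)$. In particular, $R_{\mathrm{list}}(K_{1,r},k)=(r-1)k+1=R(K_{1,r},k)$ whenever both $r$ and $k$ are even. (b) For every positive integer $k$ there exists a positive integer $w(k)$ such that the following holds: for every $k$ and every $r\ge w(k)$ that are not both even, $R_{\mathrm{list}}(K_{1,r},k)=(r-1)k+2=R(K_{1,r},k)$.
   Context: $K_n$ is the complete graph on $n$ vertices and $K_{1,r}$ is the star with $r$ edges. For a graph $G$ and a positive integer $k$, the ordinary Ramsey number $R(G,k)$ is the smallest $n$ such that every colouring of $E(K_n)$ with the colours $\{1,\dots,k\}$ contains a monochromatic copy of $G$. Given an assignment $L$ of a set $L_e\subseteq\mathbb{N}$ to each edge $e$ of $K_n$, an $L$-colouring is a function $c:E(K_n)\to\mathbb{N}$ with $c(e)\in L_e$ for all $e$. The list Ramsey number $R_{\mathrm{list}}(G,k)$ is the smallest $n$ for which there exists an assignment $L$ of lists with $|L_e|=k$ for every $e\in E(K_n)$ such that every $L$-colouring of $E(K_n)$ contains a monochromatic copy of $G$ (a not necessarily induced subgraph isomorphic to $G$ all of whose edges have the same colour). *)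

(* Defs.v *)
From mathcomp Require Import all_boot.
From mathcomp Require Import finmap.
From mathcomp Require Import boolp.

Set Implicit Arguments.
Unset Strict Implicit.
Unset Printing Implicit Defensive.

Local Open Scope fset_scope.

Record sgraph := SGraph {
  vertex :> finType;
  adj : rel vertex;
  adj_sym : symmetric adj;
  adj_irr : irreflexive adj }.

Definition edges (G : sgraph) : {set {set G}} :=
  [set [set x; y]%SET | x in G, y in G & adj x y].

Lemma neq_sym_rel (T : eqType) : symmetric (fun x y : T => x != y).
Proof. by move=> x y; rewrite eq_sym. Qed.

Lemma neq_irr_rel (T : eqType) : irreflexive (fun x y : T => x != y).
Proof. by move=> x; rewrite eqxx. Qed.

Definition complete_graph (n : nat) : sgraph :=
  SGraph (@neq_sym_rel 'I_n) (@neq_irr_rel 'I_n).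

Section CompleteBipartite.
Variables a b : nat.

Definition bip_adj (x y : 'I_a + 'I_b) : bool :=
  match x, y with
  | inl _, inr _ | inr _, inl _ => true
  | _, _ => false
  end.

Lemma bip_adj_sym : symmetric bip_adj.
Proof. by case=> ? [] ?. Qed.

Lemma bip_adj_irr : irreflexive bip_adj.
Proof. by case. Qed.

Definition complete_bipartite : sgraph := SGraph bip_adj_sym bip_adj_irr.
End CompleteBipartite.

Definition star (r : nat) : sgraph := complete_bipartite 1 r.

(* A colouring (or list assignment) of E(H) is given by a function on all sets
   of vertices; only its values on [edges H] are ever constrained or used. *)
Definition list_colouring (H : sgraph) (L : {set H} -> {fset nat})
    (c : {set H} -> nat) : Prop :=
  forall e : {set H}, e \in edges H -> c e \in L e.

(* The embedding [f] need not reflect adjacency: copies of [G] in [H] are not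
   required to be induced. *)
Definition monochromatic_copy (G H : sgraph) (c : {set H} -> nat) : Prop :=
  exists (f : G -> H) (a : nat),
    [/\ injective f,
        {homo f : x y / adj x y}
      & forall x y : G, adj x y -> c [set f x; f y]%SET = a].

Definition every_colouring_has_mono (G H : sgraph)
    (L : {set H} -> {fset nat}) : Prop :=
  forall c : {set H} -> nat, list_colouring L c -> monochromatic_copy G c.

Definition ramsey_at (G : sgraph) (k n : nat) : Prop :=
  every_colouring_has_mono G
    (fun _ : {set complete_graph n} => [fset i in iota 1 k]).

Definition list_ramsey_at (G : sgraph) (k n : nat) : Prop :=
  exists L : {set complete_graph n} -> {fset nat},
    (forall e, e \in edges (complete_graph n) -> #|` L e| = k) /\
    every_colouring_has_mono G L.

(* The smallest natural number satisfying [P]; the value is 0 when there is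
   none. *)
Definition least (P : nat -> Prop) : nat :=
  if pselect (exists n, `[< P n >]) is left exP then ex_minn exP else 0.

Lemma leastP (P : nat -> Prop) : (exists n, P n) ->
  P (least P) /\ forall m, P m -> least P <= m.
Proof.
move=> [n Pn]; rewrite /least; case: pselect => [exP|[]]; last first.
  by exists n; apply/asboolP.
case: ex_minnP => m /asboolP Pm min_m; split=> // p Pp.
by apply: min_m; apply/asboolP.
Qed.

Definition ramsey (G : sgraph) (k : nat) : nat := least (ramsey_at G k).

Definition list_ramsey (G : sgraph) (k : nat) : nat :=
  least (list_ramsey_at G k).

(* Main.v *)
Require Import Defs.
From mathcomp Require Import all_boot fingroup perm all_algebra.
From mathcomp Require Import boolp zify.
From mathcomp Require Import finmap.

Set Implicit Arguments.
Unset Strict Implicit.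
Unset Printing Implicit Defensive.

(** Write s = r - 1.  A colouring has no monochromatic star with r edges exactly
    when every colour has degree at most s at every vertex.  Counting the edges
    at one vertex bounds the Ramsey number by s k + 2, and by s k + 1 when r
    and k are even, because then on s k + 1 vertices, an odd number, every
    colour class would have to be regular of the odd degree s.  Constant lists
    are allowed, so the list Ramsey number is at most the Ramsey number, and
    what remains is to colour complete graphs on s k or s k + 1 vertices from
    arbitrary lists of size k with all colour degrees at most s.

    Most of the colour degree comes from Galvin's theorem ([galvin]): a
    bipartite multigraph with a proper k-edge-colouring is properly colourable
    from any lists of size k.  Orient the complete graph and divide the arcs
    leaving a vertex, and those entering it, into groups of at most k arcs.
    Splitting each vertex into one vertex for each of its groups yields a
    bipartite multigraph; if its edges are properly coloured with k colours,
    Galvin's theorem gives a list colouring in which each colour has degree at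
    most the number of groups at a vertex ([tournament_choosable]).  The three
    orientations used are explicit, and so are their proper colourings.
    - For s even, on s k + 1 vertices: the rotational tournament
      ([circulant_choosable]).
    - For s and k odd and s > 1, on s k + 1 = 2 h vertices: two halves, where k
      perfect matchings between them form an additional group of arcs, all
      directed from the first half to the second, and the remaining graph has
      equal in- and out-degrees ([halves_choosable]).
    - For s odd, on s k vertices: s blocks of k vertices, oriented between
      blocks along the rotational tournament with s vertices.  This uses s - 1
      groups at each vertex, and the edges inside a block are coloured properly
      by the theorem of Haggkvist and Janssen, that the complete graph on k
      vertices is properly edge-colourable from lists of size k
      ([blocks_choosable]).

    The last theorem is proved here in a stronger form
    ([symmetric_latin_choosable]) by the polynomial method of Alon and Tarsi.
    The product over all vertices v of the Vandermonde determinants in the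
    variables x_{vj} is nonzero at proper colourings only.  Its monomials come
    from labellings which give each vertex a permutation of 0, ..., n - 1 along
    its edges, the exponent of an edge being the sum of its two labels.  If
    some labelling has all its exponents below n and is the only one with these
    exponents, then the corresponding coefficient is 1 or -1, and lists of size
    n suffice ([unique_labelling_choice]).  Such a labelling is given
    explicitly ([label]); its uniqueness ([label_array_unique]) holds because
    the edges can be ordered in such a way that the labels of each edge are
    forced by those of the earlier ones. *)

(** * Unordered pairs *)

Lemma pair_setP (T : finType) (u v x y : T) :
  [set u; v] = [set x; y] -> (u, v) = (x, y) \/ (u, v) = (y, x).
Proof.
move=> eq_e; have /set2P u_xy : u \in [set x; y] by rewrite -eq_e set21.
have /set2P v_xy : v \in [set x; y] by rewrite -eq_e set22.
have /set2P x_uv : x \in [set u; v] by rewrite eq_e set21.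
have /set2P y_uv : y \in [set u; v] by rewrite eq_e set22.
by case: u_xy => ?; case: v_xy => ?; case: x_uv => ?; case: y_uv => ?; subst; auto.
Qed.

(** * Galvin's theorem *)

Section Galvin.
Variables (E : finType) (A B : eqType) (src : E -> A) (tgt : E -> B).
Variable col : E -> nat.

(** Every edge prefers larger colours at its source and smaller ones at its
    target; [beaten e f] says that the common end of [e] and [f] prefers [f]. *)
Definition beaten (e f : E) :=
  (src e == src f) && (col e < col f) || (tgt e == tgt f) && (col f < col e).

(** A stable matching of the edges in [X].  If the favourite edges of all
    sources form a matching, it is stable.  Otherwise two edges [e] and [f]
    meet at a target preferring [e], with [e] the favourite of its source; then
    [f] can be discarded, since [f] is beaten either by [e], if [e] is chosen,
    or by the edge which beats [e], necessarily at the common target. *)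
Lemma kernel_exists (X : {set E}) : exists K : {set E},
  [/\ K \subset X, {in K &, forall e f, ~~ beaten e f} &
      {in X :\: K, forall e, exists2 f, f \in K & beaten e f}].
Proof.
have [m] := ubnP #|X|; elim: m => // m IHm in X *; rewrite ltnS => leX.
pose top e := [forall (g | (g \in X) && (src g == src e)), col g <= col e].
have topP e g : top e -> g \in X -> src e == src g -> col e < col g -> False.
  move=> /'forall_implyP/(_ g) topE gX; rewrite eq_sym => eg.
  by rewrite ltnNge topE // gX.
have [[e f] /= /and4P[top_e fX eq_ef lt_ef]|no_clash] := pickP (fun p : E * E =>
    [&& (p.1 \in X) && top p.1, p.2 \in X, tgt p.1 == tgt p.2 & col p.1 < col p.2]).
  have [eX {}top_e] := andP top_e.
  have [|K [subK indepK domK]] := IHm (X :\ f).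
    by rewrite (cardsD1 f) fX in leX.
  exists K; split=> // [|g]; first by apply: subset_trans subK (subD1set _ _).
  rewrite inE => /andP[gK gX]; have [->|neq_gf] := eqVneq g f; last first.
    by apply: domK; rewrite !inE gK neq_gf.
  have [eK|eK] := boolP (e \in K).
    by exists e => //; rewrite /beaten [tgt f == _]eq_sym eq_ef lt_ef orbT.
  have [|h hK /orP[/andP[eh lt_h]|/andP[eh lt_h]]] := domK e.
  - by rewrite !inE eK eX andbT; apply: contraTneq lt_ef => ->; rewrite ltnn.
  - by case: (topP e h) => //; move: (subsetP subK _ hK); rewrite inE => /andP[].
  - exists h => //; rewrite /beaten (ltn_trans lt_h lt_ef) -(eqP eq_ef) eh.
    by rewrite orbT.
exists [set e in X | top e]; split.
- by apply/subsetP => e; rewrite inE => /andP[].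
- move=> e f; rewrite !inE => /andP[eX top_e] /andP[fX top_f].
  apply/negP => /orP[/andP[eq_ef lt_ef]|/andP[eq_ef lt_fe]].
    exact: (topP e f).
  by have := no_clash (f, e); rewrite /= fX top_f eX eq_sym eq_ef lt_fe.
move=> e; rewrite !inE => /andP[n_top eX]; rewrite eX /= in n_top.
pose Y := [pred g | (g \in X) && (src g == src e)].
have Ye : Y e by rewrite /= eX eqxx.
case: (arg_maxnP col Ye) => f /andP[fX /eqP eq_fe] max_f.
have top_f : top f.
  by apply/'forall_implyP => g; rewrite eq_fe => /max_f.
exists f; first by rewrite inE fX.
rewrite /beaten eq_fe eqxx /= ltn_neqAle (max_f e Ye : col e <= col f) andbT.
apply/orP; left; apply: contra n_top => /eqP eq_col.
by apply/'forall_implyP => g Yg; rewrite eq_col; apply: max_f.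
Qed.

(** Give a colour [a] to a kernel of the set of edges whose list contains [a],
    and delete [a] from the other lists: an edge which loses a colour in this
    way also loses one of the edges beating it, so the hypothesis persists. *)
Lemma kernel_colouring (X : {set E}) (L : E -> {fset nat}) :
    {in X, forall e, #|[set f in X | beaten e f]| < #|` L e|%fset} ->
  exists c : E -> nat, {in X, forall e, c e \in L e} /\
    {in X &, forall e f, beaten e f -> c e != c f}.
Proof.
have [m] := ubnP #|X|; elim: m => // m IHm in X L *; rewrite ltnS => leX bigL.
have [->|[e0 e0X]] := set_0Vmem X.
  by exists (fun=> 0); split=> [e|e f]; rewrite inE.
have /fset0Pn[a aL] : L e0 != fset0.
  by rewrite -cardfs_gt0; apply: leq_trans (bigL _ e0X).
have [K [subK indepK domK]] := kernel_exists [set e in X | a \in L e].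
have KX e : e \in K -> e \in X /\ a \in L e.
  by move/(subsetP subK); rewrite inE => /andP[].
have [|e|c [cL c_ok]] := IHm (X :\: K) (fun e => L e `\ a)%fset.
- have [f fK] : exists f, f \in K.
    have [e0K|e0K] := boolP (e0 \in K); first by exists e0.
    by have [|f fK _] := domK e0; [rewrite !inE e0K e0X|exists f].
  apply: leq_trans leX; apply: proper_card; apply/properP; split.
    exact: subsetDl.
  by exists f; [case: (KX f) | rewrite inE fK].
- rewrite inE => /andP[eK eX]; have := bigL e eX.
  have subX : [set f in X :\: K | beaten e f] \subset [set f in X | beaten e f].
    by apply/subsetP => f; rewrite !inE => /andP[/andP[_ ->]].
  rewrite (cardfsD1 a (L e)); have [aLe|_] /= := boolP (a \in L e); last first.
    by rewrite add0n; apply: leq_ltn_trans; apply: subset_leq_card.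
  rewrite add1n ltnS; apply: leq_trans; apply: proper_card.
  apply/properP; split=> //; have [|f fK ef] := domK e; first by rewrite !inE eK eX.
  by exists f; rewrite !inE ?fK ?ef ?andbT //; case: (KX f fK).
exists (fun e => if e \in K then a else c e); split=> [e eX|e f eX fX ef].
  case: ifP => eK; first by case: (KX e eK).
  by have := cL e; rewrite !inE eK eX => /(_ isT)/andP[].
have c_neq g : g \in X -> g \notin K -> c g != a.
  by move=> gX gK; have := cL g; rewrite !inE gK gX => /(_ isT)/andP[].
have [eK|eK] := boolP (e \in K); have [fK|fK] := boolP (f \in K).
- by have := indepK _ _ eK fK; rewrite ef.
- by rewrite eq_sym c_neq.
- by rewrite c_neq.
- by apply: c_ok; rewrite ?inE ?eK ?fK.
Qed.

Theorem galvin k (L : E -> {fset nat}) :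
    (forall e, col e < k) ->
    (forall e f, src e = src f -> col e = col f -> e = f) ->
    (forall e f, tgt e = tgt f -> col e = col f -> e = f) ->
    (forall e, k <= #|` L e|%fset) ->
  exists c : E -> nat, (forall e, c e \in L e) /\
    forall e f, c e = c f -> src e = src f \/ tgt e = tgt f -> e = f.
Proof.
move=> lt_col src_inj tgt_inj leL.
have [e _|c [cL c_ok]] := @kernel_colouring setT L.
  (* The edges beating [e] have pairwise distinct colours, all distinct from the
     colour of [e]: larger ones at the source, smaller ones at the target. *)
  apply: leq_trans (leL e); rewrite -[k in X in _ < X]card_ord.
  pose colk f : 'I_k := Ordinal (lt_col f).
  rewrite -(card_in_imset (f := colk)) => [|f g]; last first.
    rewrite !inE /beaten => Hf Hg [] eq_col.
    case/orP: Hf Hg => /andP[/eqP ef lt_f] /orP[] /andP[/eqP eg lt_g]; try lia.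
      by apply: src_inj => //; rewrite -ef.
    by apply: tgt_inj => //; rewrite -ef.
  rewrite -[X in _ < X]cardsT; apply: proper_card; apply/properP; split=> //.
  exists (colk e); first by rewrite inE.
  apply/imsetP => -[f]; rewrite !inE /beaten => Hf [] eq_col.
  by rewrite eq_col ltnn !andbF in Hf.
exists c; split=> [e|e f eq_c adj]; first exact: cL.
have no_beat g h : c g = c h -> beaten g h -> False.
  by move=> eq_gh bgh; have := c_ok g h; rewrite !inE eq_gh eqxx => /(_ isT isT bgh).
case: (ltngtP (col e) (col f)) => [lt_c|lt_c|eq_col].
- by case: adj => eq_ef; [case: (no_beat e f)|case: (no_beat f e)];
     rewrite // /beaten eq_ef eqxx lt_c ?orbT.
- by case: adj => eq_ef; [case: (no_beat f e)|case: (no_beat e f)];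
     rewrite // /beaten eq_ef eqxx lt_c ?orbT.
- by case: adj => eq_ef; [apply: src_inj|apply: tgt_inj].
Qed.

End Galvin.

(** * The method of Alon and Tarsi *)

Section AlonTarsi.
Import GRing.Theory.
Local Open Scope ring_scope.

(** Summation against the weights [w] extracts the coefficient of degree [d] of
    a polynomial of degree less than [n] from its values at the points [a]. *)
Lemma extraction_weights (F : fieldType) n (a : 'I_n -> F) (d : nat) :
  injective a -> (d < n)%N ->
  exists w : 'I_n -> F, forall p : nat, (p < n)%N ->
    \sum_k w k * a k ^+ p = (p == d)%:R.
Proof.
move=> inj_a ltdn; pose V := Vandermonde n (\row_k a k).
have unitV : V \in unitmx.
  rewrite unitmxE unitfE det_Vandermonde.
  apply/prodf_neq0 => i _; apply/prodf_neq0 => j lt_ij.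
  rewrite !mxE subr_eq0; apply: contraTneq lt_ij => /inj_a ->.
  by rewrite ltnn.
pose w := invmx V *m delta_mx (Ordinal ltdn) (0 : 'I_1).
exists (fun k => w k 0) => p ltpn.
have /matrixP/(_ (Ordinal ltpn) 0) : V *m w = delta_mx (Ordinal ltdn) 0.
  by rewrite mulKVmx.
rewrite !mxE andbT -val_eqE /= => <-.
by apply: eq_bigr => k _; rewrite !mxE mulrC.
Qed.

(** The combinatorial Nullstellensatz, for a polynomial written as a sum of
    monomials.  The weighted sum of its values over the whole grid is the
    coefficient of the monomial [t0]: by homogeneity, every other monomial has
    an exponent smaller than the one in [t0], so its weighted sum vanishes. *)
Lemma nonvanishing_choice (F : fieldType) n (I J : finType)
    (coef : J -> F) (m : J -> I -> nat) (t0 : J) (a : I -> 'I_n -> F) :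
    (forall i, injective (a i)) -> coef t0 != 0 ->
    (forall i, m t0 i < n)%N ->
    (forall t, \sum_i m t i = \sum_i m t0 i)%N ->
    (forall t, m t =1 m t0 -> t = t0) ->
  exists g : I -> 'I_n,
    \sum_t coef t * \prod_i a i (g i) ^+ m t i != 0.
Proof.
move=> inj_a nz_coef lt_m homog uniq_t0.
have /fin_all_exists[w wP] i := extraction_weights (inj_a i) (lt_m i).
pose P (g : {ffun I -> 'I_n}) := \sum_t coef t * \prod_i a i (g i) ^+ m t i.
have sumP : \sum_(g : {ffun I -> 'I_n}) (\prod_i w i (g i)) * P g = coef t0.
  transitivity (\sum_t coef t * \prod_i \sum_k w i k * a i k ^+ m t i).
    under [RHS]eq_bigr do rewrite bigA_distr_bigA big_distrr.
    rewrite [RHS]exchange_big; apply: eq_bigr => g _.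
    rewrite big_distrr; apply: eq_bigr => t _ /=.
    by rewrite big_split /= mulrCA.
  rewrite (bigD1 t0) //= [X in _ + X]big1 ?addr0.
    by rewrite big1 ?mulr1 // => i _; rewrite wP ?eqxx.
  move=> t neq_t.
  have [i lt_i|le_m] := pickP (fun i => m t i < m t0 i)%N.
    rewrite (bigD1 i) //= wP ?(ltn_trans lt_i) //.
    by rewrite (ltn_eqF lt_i) mul0r mulr0.
  case/eqP: neq_t; apply: uniq_t0 => i; apply/esym/eqP.
  have [|_] := @leqif_sum I predT (fun i => m t0 i == m t i) (m t0) (m t).
    by move=> j _; split=> //; rewrite leqNgt le_m.
  by rewrite /= homog eqxx => /esym/forallP/(_ i).
have [g nzPg|P0] := pickP (fun g : {ffun I -> 'I_n} => P g != 0); first by exists g.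
case/eqP: nz_coef; rewrite -sumP big1 // => g _.
by have /negbFE/eqP -> := P0 g; rewrite mulr0.
Qed.

(** The variables are indexed by the sets [[set v; j]]; for [j = v] this is a
    loop at [v], which makes the labels at [v] a permutation of ['I_n] and its
    polynomial a square Vandermonde determinant. *)
Lemma unique_labelling_choice (F : fieldType) n (M0 : {ffun 'I_n -> 'S_n})
    (a : {set 'I_n} -> 'I_n -> F) :
    (0 < n)%N -> (forall e, injective (a e)) ->
    (forall i j, i != j -> M0 i j + M0 j i < n)%N ->
    (forall M : {ffun 'I_n -> 'S_n}, (forall i, M i i = M0 i i) ->
      (forall i j, i != j -> M i j + M j i = M0 i j + M0 j i)%N -> M = M0) ->
  exists g : {set 'I_n} -> 'I_n,
    forall v, injective (fun j => a [set v; j] (g [set v; j])).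
Proof.
move=> n_gt0 inj_a lt_M0 uniq_M0.
pose coef (M : {ffun 'I_n -> 'S_n}) : F := \prod_v (-1) ^+ M v.
pose m (M : {ffun 'I_n -> 'S_n}) (e : {set 'I_n}) :=
  (\sum_(p : 'I_n * 'I_n | [set p.1; p.2] == e) M p.1 p.2)%N.
have m_loop M i : m M [set i; i] = M i i.
  rewrite /m (big_pred1 (i, i)) // => -[u v] /=.
  rewrite xpair_eqE setUid; apply/eqP/andP => [/setP eq_e|[/eqP-> /eqP->]].
    by rewrite -!in_set1 -!eq_e !inE !eqxx orbT.
  by rewrite setUid.
have m_edge M i j : i != j -> m M [set i; j] = (M i j + M j i)%N.
  move=> nij; rewrite /m (bigD1 (i, j)) //= (big_pred1 (j, i)) // => -[u v] /=.
  rewrite !xpair_eqE; apply/andP/andP=> [[/eqP/setP eq_e]|[/eqP-> /eqP->]].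
    have := eq_e u; have := eq_e v; rewrite !inE !eqxx orbT /=.
    have := eq_e i; have := eq_e j; rewrite !inE !eqxx orbT /=.
    rewrite ![i == _]eq_sym ![j == _]eq_sym.
    by do 4!case: eqP => //=.
  by rewrite setUC eqxx negb_and eq_sym nij.
have [||||g nz] := @nonvanishing_choice F n _ _ coef m M0 a inj_a.
- by apply/prodf_neq0 => v _; rewrite signr_eq0.
- move=> e.
  have [p /eqP <- /=|no_p] := pickP (fun p : 'I_n * 'I_n => [set p.1; p.2] == e).
    case: p => i j /=; have [->|nij] := eqVneq i j; first by rewrite m_loop.
    by rewrite m_edge ?lt_M0.
  by rewrite /m big_pred0.
- have total M : (\sum_e m M e = \sum_(i < n) \sum_(k < n) k)%N.
    transitivity (\sum_(p : 'I_n * 'I_n) M p.1 p.2)%N.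
      by rewrite [RHS](partition_big (fun p => [set p.1; p.2]) predT).
    rewrite -(pair_bigA _ (fun i j => M i j : nat)) /=.
    by apply: eq_bigr => i _; rewrite [RHS](reindex_inj (@perm_inj _ (M i))).
  by move=> M; rewrite !total.
- move=> M eqM; apply: uniq_M0 => [i|i j nij].
    by apply: val_inj; rewrite /= -!m_loop.
  by rewrite -!m_edge.
exists g => v j1 j2 eq_j; apply/eqP; apply: contraNT nz => neq_j.
pose x e := a e (g e).
suff -> : \sum_M coef M * \prod_e x e ^+ m M e =
    \prod_u \det (\matrix_(j, k < n) x [set u; j] ^+ k).
  rewrite (bigD1 v) //= (determinant_alternate neq_j) ?mul0r // => k.
  by rewrite !mxE /x eq_j.
rewrite /determinant bigA_distr_bigA; apply: eq_bigr => M _.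
rewrite big_split; congr (_ * _); rewrite pair_bigA /=.
rewrite (partition_big (fun p => [set p.1; p.2]) predT) //=.
apply: eq_bigr => e _; rewrite -prodrXr.
by apply: eq_bigr => -[i j] /= /eqP <-; rewrite mxE.
Qed.

End AlonTarsi.

(** * A labelling determined by its edge sums *)

(** The residue of [i + j] modulo [n], for [i] and [j] less than [n]. *)
Definition diagonal (n i j : nat) := if i + j < n then i + j else i + j - n.

(** The diagonals 0, 1, 2, 3, ... receive n - 1, 0, n - 2, 1, ...; this is the
    label at one of the two ends of each edge of the diagonal. *)
Definition zigzag (n s : nat) := if odd s then s./2 else n.-1 - s./2.

(** The labels of an edge add up to n - 2 or n - 1, according to whether
    [i + j < n].  The value on the main diagonal is the one which makes each
    row a permutation. *)
Definition label (n i j : nat) :=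
  let c := zigzag n (diagonal n i j) in
  if i == j then n.-1 - i %% uphalf n
  else if i + j < n then (if j < i then c else n - 2 - c)
  else (if i < j then c else n.-1 - c).

(** The edges of one diagonal are determined in the order given by [spread]. *)
Definition spread (n i j : nat) :=
  let d := (i - j) + (j - i) in
  if odd (diagonal n i j) == (i + j < n) then n - d else d.

(** Suppose that the labels are known on the diagonals before that of [i] and
    [j].  At every vertex the labels still free form an interval, and the leader
    is an end at which [label] takes the largest one. *)
Definition leader (n i j : nat) :=
  odd (diagonal n i j) (+) (i + j < n) (+) (i < j).

(** The definitions above as linear equations, in the eight cases given by the
    parity of the diagonal, by [i + j < n] and by [i < j]. *)
Lemma labelP n i j : i < n -> j < n -> i <> j -> exists k s d x,
  [/\ diagonal n i j = s, spread n i j = d, label n i j = x, s < n &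
  (leader n i j /\
  [\/ [/\ s = 2 * k, i + j = s, i = d + j & x + k + 1 = n],
      [/\ s = 2 * k + 1, i + j = s, d + j = n + i /\ i < j & x + k + 2 = n],
      [/\ s = 2 * k, i + j = n + s, d + j = n + i /\ i < j & x + k + 1 = n] |
      [/\ s = 2 * k + 1, i + j = n + s, i = d + j & x + k + 1 = n]])
 \/
 (leader n i j = false /\
  [\/ [/\ s = 2 * k, i + j = s, j = d + i & x + 1 = k],
      [/\ s = 2 * k + 1, i + j = s, d + i = n + j /\ j < i & x = k],
      [/\ s = 2 * k, i + j = n + s, d + i = n + j /\ j < i & x = k] |
      [/\ s = 2 * k + 1, i + j = n + s, j = d + i & x = k]])].
Proof.
move=> li lj ne; exists (diagonal n i j)./2.
exists (diagonal n i j), (spread n i j), (label n i j).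
have def_s : diagonal n i j = odd (diagonal n i j) + 2 * (diagonal n i j)./2.
  by rewrite mul2n odd_double_half.
have sum_s : (i + j < n /\ diagonal n i j = i + j) \/
             (n <= i + j /\ diagonal n i j + n = i + j).
  by rewrite /diagonal; case: ltnP => h; [left|right]; split=> //; lia.
split=> //; first lia.
rewrite /leader /label /spread /zigzag.
have -> : (i == j) = false by apply/eqP.
move: def_s sum_s; move: (diagonal n i j) => s.
case: (odd s); rewrite /= ?add0n => def_s [] [lt_ij sum_s];
  rewrite ?lt_ij 1?ltnNge ?lt_ij /=; case: (ltngtP i j) => [lt|lt|//] /=.
- by left; split=> //; apply: Or42; split; lia.
- by right; split=> //; apply: Or42; split; lia.
- by right; split=> //; apply: Or44; split; lia.
- by left; split=> //; apply: Or44; split; lia.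
- by right; split=> //; apply: Or41; split; lia.
- by left; split=> //; apply: Or41; split; lia.
- by left; split=> //; apply: Or43; split; lia.
- by right; split=> //; apply: Or43; split; lia.
Qed.

Lemma label_diag n i : i < n -> exists x, label n i i = x /\
  (i < uphalf n /\ x + i + 1 = n \/ uphalf n <= i /\ x + i + 1 = n + uphalf n).
Proof.
move=> lin; exists (label n i i); split=> //; rewrite /label eqxx.
have def_n := odd_double_half n; have def_u := uphalf_half n.
case: (ltnP i (uphalf n)) => lt_i; first by left; rewrite modn_small; lia.
right; split=> //.
suff -> : i %% uphalf n = i - uphalf n by lia.
by rewrite -{1}(subnK lt_i) modnDr modn_small; lia.
Qed.

Lemma label_sum n i j : i < n -> j < n -> i <> j ->
  label n i j + label n j i = (n <= i + j) + (n - 2).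
Proof.
move=> li lj ne; have ne' : j <> i by lia.
have [k [s [d [x [_ _ -> ls H]]]]] := labelP li lj ne.
have [k' [s' [d' [x' [_ _ -> ls' H']]]]] := labelP lj li ne'.
case: leqP => c; case: H => -[_ []] []; intros; case: H' => -[_ []] []; intros; lia.
Qed.

Lemma label_ltn n i j : i < n -> j < n -> label n i j < n.
Proof.
move=> li lj; have [->|/eqP ne] := eqVneq i j.
  by have [x [-> H]] := label_diag lj; lia.
have [k [s [d [x [_ _ -> ls H]]]]] := labelP li lj ne.
by case: H => -[_ []] []; intros; lia.
Qed.

Lemma label_inj n i j w : i < n -> j < n -> w < n ->
  label n i j = label n i w -> j = w.
Proof.
move=> li lj lw.
have [<-|/eqP nij] := eqVneq i j; have [<-//|/eqP niw] := eqVneq i w.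
- have [x [-> D]] := label_diag li.
  have [k [s [d [y [_ _ -> ls H]]]]] := labelP li lw niw.
  by case: H => -[_ []] []; intros; lia.
- have [x [-> D]] := label_diag li.
  have [k [s [d [y [_ _ -> ls H]]]]] := labelP li lj nij.
  by case: H => -[_ []] []; intros; lia.
have [k [s [d [x [_ _ -> ls H]]]]] := labelP li lj nij.
have [k' [s' [d' [x' [_ _ -> ls' H']]]]] := labelP li lw niw.
by case: H => -[_ []] []; intros; case: H' => -[_ []] []; intros; lia.
Qed.

Lemma leader_total n i j : i < n -> j < n -> i <> j -> leader n i j \/ leader n j i.
Proof.
move=> _ _ nij; rewrite /leader /diagonal [j + i]addnC.
case: (ltngtP i j) => [_|_|//]; move: (odd _ (+) _) => []; by [left|right].
Qed.

(** If [i] gave its label on [j] to another edge [{i, w}], not treated before,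
    then [w] would need on this edge the complementary label, which [label]
    assigns to some [{w, v}].  The claim is that [{w, v}] was treated before
    [{i, j}], so that this label is already taken at [w]. *)
Lemma leader_forced n i j w v : i < n -> j < n -> w < n -> v < n ->
    i <> j -> i <> w -> w <> j -> w <> v -> leader n i j ->
    diagonal n i j <= diagonal n i w ->
    (diagonal n i j < diagonal n w v) \/
      (diagonal n i j = diagonal n w v) /\ (spread n i j <= spread n w v) ->
  label n i j + label n w v <> label n i w + label n w i.
Proof.
move=> li lj lw lv nij niw nwj nwv lead.
rewrite label_sum //.
have [k [s [d [x [-> -> -> ls H]]]]] := labelP li lj nij.
have [k1 [s1 [d1 [x1 [-> _ _ ls1 H1]]]]] := labelP li lw niw.
have [k2 [s2 [d2 [x2 [-> -> -> ls2 H2]]]]] := labelP lw lv nwv.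
move: H; rewrite lead => -[[_ H]|[//]] le_s1 le_s2.
have {}H1 : (s1 = i + w /\ i + w < n) \/ i + w = n + s1.
  by move: H1 => [] [_ []] []; intros; lia.
(* [j] is the only neighbour of [i] on the diagonal [s]. *)
have lt_s1 : s < s1.
  have : (s = i + j /\ i + j < n) \/ i + j = n + s by move: H => [] []; intros; lia.
  lia.
case: leqP => c; rewrite /= ?add0n ?add1n.
all: case: H => -[]; intros.
all: case: H2 => -[_ []] []; intros.
all: lia.
Qed.

(** The label [M0 i j] cannot be moved to another edge at [i] without clashing
    with an edge of rank less than that of [{i, j}]. *)
Definition forced n (M0 : 'I_n -> 'S_n) (rk : 'I_n -> 'I_n -> nat) i j :=
  forall w v, w != i -> w != j -> v != w ->
    rk i j <= rk i w -> rk i j <= rk w v -> M0 i j + M0 w v <> M0 i w + M0 w i.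

(** Induction on the rank: by [forced] one end of the edge keeps its label, and
    the label at the other end follows from their sum. *)
Lemma ranked_labelling_unique n (M0 M : 'I_n -> 'S_n) rk :
    (forall i j, rk i j = rk j i) ->
    (forall i, M i i = M0 i i) ->
    (forall i j, i != j -> M i j + M j i = M0 i j + M0 j i) ->
    (forall i j, i != j -> forced M0 rk i j \/ forced M0 rk j i) ->
  forall i, M i = M0 i.
Proof.
move=> rkC diagM sumM forcedM0.
suff agree i j : M i j = M0 i j by move=> i; apply/permP.
(* Below, [w] is the place where [M] puts the label [M0 i j], and [v] the place
   where [M0] puts the label of [M] at [w] on the edge [{i, w}]. *)
have [r] := ubnP (rk i j); elim: r => // r IHr in i j *; rewrite ltnS => le_r.
have [->//|nij] := eqVneq i j.
wlog lead : i j nij le_r / forced M0 rk i j.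
  move=> IH; have nji : j != i by rewrite eq_sym.
  case: (forcedM0 _ _ nij) => lead; first exact: IH.
  apply: val_inj; apply: (@addIn (M j i)); rewrite sumM // (IH j i) //.
  by rewrite -rkC.
have IH u t : rk u t < rk i j -> M u t = M0 u t.
  by move=> lt_r; apply: IHr; apply: leq_trans lt_r le_r.
pose w := ((M i)^-1 (M0 i j))%g.
have Mw : M i w = M0 i j by rewrite permKV.
have [e|nwj] := eqVneq w j; first by rewrite -[in LHS]e.
have nwi : w != i.
  apply: contraNneq nij => e; move: Mw; rewrite e diagM.
  by move/perm_inj => ->.
have le_iw : rk i j <= rk i w.
  rewrite leqNgt; apply/negP => /IH; rewrite Mw => /perm_inj ejw.
  by case/eqP: nwj.
pose v := ((M0 w)^-1 (M w i))%g.
have Mv : M0 w v = M w i by rewrite permKV.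
have nvw : v != w.
  apply: contraNneq nwi => e; move: Mv; rewrite e -diagM.
  by move/perm_inj => ->.
have le_wv : rk i j <= rk w v.
  rewrite leqNgt; apply/negP => lt_r; move: Mv; rewrite -IH // => /perm_inj e.
  by move: lt_r; rewrite e -rkC ltnNge le_iw.
case: (lead w v) => //; rewrite Mv -Mw sumM //.
by rewrite eq_sym.
Qed.

Lemma label_perm n (i : 'I_n) :
  {s : 'S_n | forall j : 'I_n, s j = label n i j :> nat}.
Proof.
pose f (j : 'I_n) : 'I_n := Ordinal (label_ltn (ltn_ord i) (ltn_ord j)).
have inj_f : injective f.
  by move=> j w [] /label_inj e; apply: val_inj; apply: e.
by exists (perm inj_f) => j; rewrite permE.
Qed.

Definition label_array n : {ffun 'I_n -> 'S_n} := [ffun i => sval (label_perm i)].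

Lemma label_arrayE n (i j : 'I_n) : label_array n i j = label n i j :> nat.
Proof. by rewrite ffunE (svalP (label_perm i)). Qed.

Lemma label_array_unique n (M : {ffun 'I_n -> 'S_n}) :
    (forall i, M i i = label_array n i i) ->
    (forall i j, i != j ->
       M i j + M j i = label_array n i j + label_array n j i) ->
  M = label_array n.
Proof.
move=> diagM sumM; apply/ffunP.
pose rk (i j : 'I_n) := diagonal n i j * n.+1 + spread n i j.
have diagC i j : diagonal n i j = diagonal n j i by rewrite /diagonal addnC.
have spreadC i j : spread n i j = spread n j i.
  by rewrite /spread diagC [i + j]addnC [_ - _ + _]addnC.
have spread_le i j : i < n -> j < n -> spread n i j <= n.
  by rewrite /spread; case: ifP; lia.
have rk_le i j i' j' : rk i j <= rk i' j' ->
    diagonal n i j < diagonal n i' j' \/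
    diagonal n i j = diagonal n i' j' /\ spread n i j <= spread n i' j'.
  have := spread_le _ _ (ltn_ord i') (ltn_ord j').
  rewrite /rk; case: (ltngtP (diagonal n i j) (diagonal n i' j')).
  - by left.
  - move=> lt_d le_n le_rk; have := leq_mul lt_d (leqnn n.+1).
    by move: le_rk; rewrite mulSn; lia.
  - by move=> ->; rewrite leq_add2l; right.
apply: (@ranked_labelling_unique _ _ _ rk) => // [i j|i j nij].
  by rewrite /rk diagC spreadC.
have leader_forces (i' j' : 'I_n) :
    i' != j' -> leader n i' j' -> forced (label_array n) rk i' j'.
  move=> ne lead w v nwi nwj nvw /rk_le le_iw /rk_le le_wv.
  rewrite !label_arrayE; apply: leader_forced => //;
    try (by apply/eqP; rewrite // eq_sym).
  by case: le_iw => [/ltnW//|[-> //]].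
case: (@leader_total n i j) => //; first by apply/eqP.
  by left; apply: leader_forces.
by right; apply: leader_forces; rewrite // eq_sym.
Qed.

(** The theorem of Haggkvist and Janssen, strengthened by a loop at each vertex:
    a symmetric array can be filled from lists of size [n] in such a way that
    each row has pairwise distinct entries. *)
Theorem symmetric_latin_choosable n (L : {set 'I_n} -> {fset nat}) :
    0 < n -> (forall e, n <= #|` L e|%fset) ->
  exists c : {set 'I_n} -> nat, (forall e, c e \in L e) /\
    forall v, injective (fun j => c [set v; j]).
Proof.
move=> n_gt0 leL; pose s e := enum_fset (L e).
have lt_s e (k : 'I_n) : k < size (s e) by apply: leq_trans (ltn_ord k) (leL e).
pose a e (k : 'I_n) : rat := ((nth 0%N (s e) k)%:R)%R.
have inj_a e : injective (a e).
  move=> k k' /eqP; rewrite Num.Theory.eqr_nat nth_uniq ?fset_uniq //.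
  by move/eqP/val_inj.
have [|g inj_g] := unique_labelling_choice n_gt0 inj_a _ (@label_array_unique n).
  move=> i j nij; rewrite !label_arrayE label_sum //; last exact/eqP.
  by move: nij (ltn_ord i) (ltn_ord j); rewrite -val_eqE /=; lia.
exists (fun e => nth 0 (s e) (g e)); split=> [e|v j j' eq_c].
  exact: mem_nth.
by apply: (inj_g v); congr (_ %:R)%R; exact: eq_c.
Qed.

(** * List colourings from labelled orientations *)

Definition colour_degree n (c : {set 'I_n} -> nat) (v : 'I_n) (a : nat) :=
  #|[set u | (u != v) && (c [set v; u] == a)]|.

(** For [s = 1] this is edge-choosability of the complete graph. *)
Definition choosable n k s := forall L : {set 'I_n} -> {fset nat},
  (forall e, k <= #|` L e|%fset) ->
  exists c : {set 'I_n} -> nat, (forall e, c e \in L e) /\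
    forall v a, colour_degree c v a <= s.

Section Orientation.
Variables (n k : nat) (arc : rel 'I_n) (grp col : 'I_n -> 'I_n -> nat).
Hypothesis k_gt0 : 0 < k.
Hypothesis arc_asym : forall u v, arc u v -> ~~ arc v u.
Hypothesis lt_col : forall u v, arc u v -> col u v < k.
Hypothesis out_inj : forall u v w, arc u v -> arc u w ->
  grp u v = grp u w -> col u v = col u w -> v = w.
Hypothesis in_inj : forall u v w, arc v u -> arc w u ->
  grp v u = grp w u -> col v u = col w u -> v = w.

(** Galvin's theorem for the bipartite multigraph in which each arc [(u, v)]
    joins the copy of [u] for its group among the sources to the copy of [v]
    for its group among the targets. *)
Lemma oriented_colouring (L : {set 'I_n} -> {fset nat}) :
    (forall e, k <= #|` L e|%fset) ->
  exists c : {set 'I_n} -> nat, [/\ forall e, c e \in L e,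
    forall u v w, arc u v -> arc u w -> grp u v = grp u w ->
      c [set u; v] = c [set u; w] -> v = w &
    forall u v w, arc v u -> arc w u -> grp v u = grp w u ->
      c [set v; u] = c [set w; u] -> v = w].
Proof.
move=> leL; pose A := {p : 'I_n * 'I_n | arc p.1 p.2}.
pose ends (p : A) := [set (val p).1; (val p).2].
pose g (p : A) := grp (val p).1 (val p).2.
have [||||c [cL c_ok]] := @galvin A _ _ (fun p => ((val p).1, g p))
    (fun p => ((val p).2, g p)) (fun p => col (val p).1 (val p).2) k (L \o ends).
- by case=> -[u v] /= /lt_col.
- move=> [[u v] auv] [[u' w] auw] /= [e]; subst u' => eq_g eq_col.
  by apply: val_inj; rewrite /= (out_inj auv auw eq_g eq_col : v = w).
- move=> [[u v] auv] [[w v'] awv] /= [e]; subst v' => eq_g eq_col.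
  by apply: val_inj; rewrite /= (in_inj auv awv eq_g eq_col : u = w).
- by move=> p; apply: leL.
have arc_colour u v (auv : arc u v) :
    forall p : A, ends p = [set u; v] -> c p = c (exist _ (u, v) auv).
  case=> -[x y] axy; case/pair_setP=> -[ex ey]; subst x y.
    by congr c; apply: val_inj.
  by have := arc_asym auv; rewrite axy.
pose c' e := if [pick p : A | ends p == e] is Some p then c p
             else nth 0 (enum_fset (L e)) 0.
have c'E u v (auv : arc u v) : c' [set u; v] = c (exist _ (u, v) auv).
  rewrite /c'; case: pickP => [p /eqP /arc_colour -> //|].
  by move/(_ (exist _ (u, v) auv)); rewrite eqxx.
exists c'; split=> [e|u v w auv auw eq_g|u v w avu awu eq_g].
- rewrite /c'; case: pickP => [p /eqP <-|_]; first exact: cL.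
  by apply/mem_nth/(leq_trans k_gt0)/leL.
- rewrite !c'E => /c_ok same; suff /same [] : (u, grp u v) = (u, grp u w) \/
      (v, grp u v) = (w, grp u w) by [].
  by left; rewrite eq_g.
- rewrite !c'E => /c_ok same; suff /same [] : (v, grp v u) = (w, grp w u) \/
      (u, grp v u) = (u, grp w u) by [].
  by right; rewrite eq_g.
Qed.

Lemma oriented_degree (c : {set 'I_n} -> nat) (u : 'I_n) (a p q : nat) :
    (forall u v w, arc u v -> arc u w -> grp u v = grp u w ->
      c [set u; v] = c [set u; w] -> v = w) ->
    (forall u v w, arc v u -> arc w u -> grp v u = grp w u ->
      c [set v; u] = c [set w; u] -> v = w) ->
    (forall v, arc u v -> grp u v < p) -> (forall v, arc v u -> grp v u < q) ->
  #|[set v | (arc u v || arc v u) && (c [set u; v] == a)]| <= p + q.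
Proof.
move=> out_ok in_ok lt_p lt_q.
have -> : [set v | (arc u v || arc v u) && (c [set u; v] == a)] =
    [set v | arc u v && (c [set u; v] == a)] :|:
    [set v | arc v u && (c [set v; u] == a)].
  by apply/setP => v; rewrite !inE [[set v; u]]setUC andb_orl.
apply: leq_trans (leq_card_setU _ _) _; apply: leq_add.
  rewrite -[p]card_ord.
  have [->|[v0]] := set_0Vmem [set v | arc u v && (c [set u; v] == a)].
    by rewrite cards0.
  rewrite inE => /andP[/lt_p/ltn_predK <- _].
  rewrite -(card_in_imset (f := fun v => inord (grp u v) : 'I_p.-1.+1)) ?max_card //.
  move=> v w; rewrite !inE => /andP[av /eqP cv] /andP[aw /eqP cw].
  move/(congr1 val); have Pp := ltn_predK (lt_p _ av).
  rewrite /= !inordK ?Pp ?lt_p // => eq_g.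
  by apply: (out_ok u); rewrite // cv cw.
rewrite -[q]card_ord.
have [->|[v0]] := set_0Vmem [set v | arc v u && (c [set v; u] == a)].
  by rewrite cards0.
rewrite inE => /andP[/lt_q/ltn_predK <- _].
rewrite -(card_in_imset (f := fun v => inord (grp v u) : 'I_q.-1.+1)) ?max_card //.
move=> v w; rewrite !inE => /andP[av /eqP cv] /andP[aw /eqP cw].
move/(congr1 val); have Pq := ltn_predK (lt_q _ av).
rewrite /= !inordK ?Pq ?lt_q // => eq_g.
by apply: (in_ok u); rewrite // cv cw.
Qed.

Lemma tournament_choosable s (p q : 'I_n -> nat) :
    (forall u v, u != v -> arc u v || arc v u) ->
    (forall u v, arc u v -> grp u v < p u) ->
    (forall u v, arc u v -> grp u v < q v) ->
    (forall u, p u + q u <= s) ->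
  choosable n k s.
Proof.
move=> total lt_p lt_q le_s L /oriented_colouring[c [cL out_ok in_ok]].
exists c; split=> // u a; apply: leq_trans (le_s u).
apply: leq_trans (oriented_degree a out_ok in_ok (lt_p u) _); last first.
  by move=> v; apply: lt_q.
apply/subset_leq_card/subsetP => v; rewrite !inE => /andP[nvu ->].
by rewrite total // eq_sym.
Qed.
End Orientation.

(** * Rotational tournaments and blocks *)

(** The residue of [y - x] modulo [m] taken between 1 and [m]. *)
Definition gap m x y := if x < y then y - x else y + m - x.

Lemma gapP m x y : x < m -> y < m -> exists2 d, gap m x y = d & 0 < d /\
  (x < y /\ x + d = y \/ y <= x /\ x + d = y + m).
Proof.
by move=> lx ly; exists (gap m x y) => //; rewrite /gap; case: (ltnP x y) => h; lia.
Qed.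

(** The arcs with a given difference form a permutation of the vertices, so the
    [q * k] differences make [q] groups of [k] colours. *)
Lemma circulant_choosable k q : 0 < k -> choosable (q * k).*2.+1 k q.*2.
Proof.
move=> k_gt0; set n := _.+1.
pose d (u v : 'I_n) := gap n u v.
pose arc (u v : 'I_n) := d u v <= q * k.
have lt_grp u v : arc u v -> (d u v).-1 %/ k < q.
  have [g] := gapP (ltn_ord u) (ltn_ord v).
  by rewrite /arc /d ltn_divLR // => ->; lia.
apply: (@tournament_choosable _ _ arc (fun u v => (d u v).-1 %/ k)
  (fun u v => (d u v).-1 %% k) _ _ _ _ _ _ (fun=> q) (fun=> q)) => //.
- move=> u v; rewrite /arc /d.
  have [g ->] := gapP (ltn_ord u) (ltn_ord v).
  by have [h ->] := gapP (ltn_ord v) (ltn_ord u); rewrite /n; lia.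
- by move=> u v _; rewrite ltn_mod.
- move=> u v w _ _ eq_g eq_c; have : (d u v).-1 = (d u w).-1.
    by rewrite (divn_eq (d u v).-1 k) eq_g eq_c -divn_eq.
  rewrite /d; have [g ->] := gapP (ltn_ord u) (ltn_ord v).
  have [h ->] := gapP (ltn_ord u) (ltn_ord w) => H1 H2 H3.
  by apply: val_inj => /=; move: (ltn_ord v) (ltn_ord w); lia.
- move=> u v w _ _ eq_g eq_c; have : (d v u).-1 = (d w u).-1.
    by rewrite (divn_eq (d v u).-1 k) eq_g eq_c -divn_eq.
  rewrite /d; have [g ->] := gapP (ltn_ord v) (ltn_ord u).
  have [h ->] := gapP (ltn_ord w) (ltn_ord u) => H1 H2 H3.
  by apply: val_inj => /=; move: (ltn_ord v) (ltn_ord w); lia.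
- move=> u v; rewrite -val_eqE /arc /d /=.
  have [g ->] := gapP (ltn_ord u) (ltn_ord v).
  by have [h ->] := gapP (ltn_ord v) (ltn_ord u); rewrite /n; lia.
- by move=> u; rewrite addnn.
Qed.

(** Between two blocks, the differences of the positions in the blocks are a
    proper colouring with [k] colours, so each vertex has one group for every
    other block. *)
Lemma blocks_choosable k q : 0 < k -> choosable (q.*2.+1 * k) k q.*2.+1.
Proof.
move=> k_gt0; set m := q.*2.+1.
have lt_blk (u : 'I_(m * k)) : u %/ k < m by rewrite ltn_divLR.
have lt_idx (u : 'I_(m * k)) : u %% k < k by rewrite ltn_mod.
pose blk u := Ordinal (lt_blk u); pose idx u := Ordinal (lt_idx u).
have lt_vtx (x : 'I_m) (i : 'I_k) : x * k + i < m * k.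
  apply: (@leq_trans (x * k + k)); first by rewrite ltn_add2l.
  by rewrite -mulSnr leq_mul2r ltn_ord orbT.
pose vtx x i := Ordinal (lt_vtx x i).
have vtxK u : vtx (blk u) (idx u) = u by apply: val_inj; rewrite /= -divn_eq.
pose arc u v := gap m (blk u) (blk v) <= q.
pose grp u v := (gap m (blk u) (blk v)).-1.
pose col u v := (gap k (idx u) (idx v)).-1.
have gapB u v := gapP (ltn_ord (blk u)) (ltn_ord (blk v)).
have gapI u v := gapP (ltn_ord (idx u)) (ltn_ord (idx v)).
have arc_total u v : blk u != blk v -> arc u v || arc v u.
  rewrite -val_eqE /arc; have [d ->] := gapB u v; have [d' ->] := gapB v u.
  by rewrite /=; lia.
have lt_grp u v : arc u v -> grp u v < q.
  by rewrite /arc /grp; have [d ->] := gapB u v; lia.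
move=> L leL.
have [||||c1 [c1L out_ok in_ok]] :=
    @oriented_colouring _ k arc grp col k_gt0 _ _ _ _ L leL.
- move=> u v; rewrite /arc; have [d ->] := gapB u v; have [d' ->] := gapB v u.
  by rewrite /m; lia.
- by move=> u v _; rewrite /col; have [d ->] := gapI u v; move: (ltn_ord (idx v)); lia.
- move=> u v w _ _; rewrite /grp /col => eq_g eq_c.
  rewrite -(vtxK v) -(vtxK w); congr vtx; apply: ord_inj.
    move: eq_g (ltn_ord (blk v)) (ltn_ord (blk w)).
    by have [d ->] := gapB u v; have [d' ->] := gapB u w; lia.
  move: eq_c (ltn_ord (idx v)) (ltn_ord (idx w)).
  by have [d ->] := gapI u v; have [d' ->] := gapI u w; lia.
- move=> u v w _ _; rewrite /grp /col => eq_g eq_c.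
  rewrite -(vtxK v) -(vtxK w); congr vtx; apply: ord_inj.
    move: eq_g (ltn_ord (blk v)) (ltn_ord (blk w)).
    by have [d ->] := gapB v u; have [d' ->] := gapB w u; lia.
  move: eq_c (ltn_ord (idx v)) (ltn_ord (idx w)).
  by have [d ->] := gapI v u; have [d' ->] := gapI w u; lia.
have /fin_all_exists[cc ccP] (x : 'I_m) :=
  @symmetric_latin_choosable k (fun e => L (vtx x @: e)) k_gt0 (fun e => leL _).
pose c (e : {set 'I_(m * k)}) :=
  if [pick u in e | e \subset [set v | blk v == blk u]] is Some u
  then cc (blk u) (idx @: e) else c1 e.
have cE u v : c [set u; v] =
    if blk u == blk v then cc (blk u) [set idx u; idx v] else c1 [set u; v].
  rewrite /c; case: pickP => [w /andP[_ /subsetP sub]|none].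
    have /[!inE]/eqP -> := sub u (set21 _ _).
    have /[!inE]/eqP -> := sub v (set22 _ _).
    by rewrite eqxx imsetU1 imset_set1.
  case: eqP => // e; have := none u; rewrite set21 /=.
  by move/subsetP; case=> w /set2P[]->; rewrite inE // e.
exists c; split=> [e|v a].
  rewrite /c; case: pickP => [u /andP[_ /subsetP sub]|_]; last exact: c1L.
  suff eK : vtx (blk u) @: (idx @: e) = e.
    by rewrite -[in L _]eK; case: (ccP (blk u)).
  rewrite -imset_comp -[RHS]imset_id; apply: eq_in_imset => w /sub.
  by rewrite inE => /eqP eb; rewrite /= -eb vtxK.
apply: (@leq_trans (#|[set u | (arc v u || arc u v) && (c1 [set v; u] == a)]|
    + #|[set u | [&& u != v, blk v == blk u & cc (blk v) [set idx v; idx u] == a]]|)).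
  apply: leq_trans (leq_card_setU _ _); apply/subset_leq_card/subsetP => u.
  rewrite !inE cE => /andP[nuv]; rewrite nuv; case: (eqVneq (blk v)) => [_ ->|nb ->].
    by rewrite orbT.
  by rewrite arc_total.
apply: (@leq_trans (q + q + 1)); last by rewrite addn1 addnn.
apply: leq_add.
  by apply: (oriented_degree _ out_ok in_ok) => u; apply: lt_grp.
apply/card_le1_eqP => u w; rewrite !inE.
move=> /and3P[_ /eqP bu /eqP cu] /and3P[_ /eqP bw /eqP cw].
rewrite -(vtxK u) -(vtxK w) -bu -bw; congr vtx.
by case: (ccP (blk v)) => _ inj_c; apply: (inj_c (idx v)); rewrite cu cw.
Qed.

(** * Two halves *)

Section Halves.
Variables h k Q : nat.
Hypothesis odd_k : odd k.
Hypothesis le_kh : k <= h.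
Hypothesis def_Q : h.*2 = Q.*2 + k + 1.

Definition pos u := if u < h then u else u - h.

(** The halves are the vertices [a_i = i] and [b_i = h + i], and for each [e]
    from 1 to [h] the edges from [a_i] to [b_(i + e)], with indices modulo [h],
    form a perfect matching.  The matchings with [e <= k] are directed from the [a_i]
    to the [b_j], and the others alternate.  If [h] is even, this leaves over the
    matching with [e = h], whose edges are [a_i b_i].  Together with the
    antipodal edges of both halves it consists of the cycles
    [a_i -> b_i -> b_(i + h/2) -> a_(i + h/2) -> a_i] for [i < h/2]. *)
Definition forward i j :=
  let e := gap h i j in
  if (e == h) && ~~ odd h then i.*2 < h
  else (e <= k) || ~~ odd (e - k.+1).

(** The arcs with a label less than [Q] form a permutation of all vertices for
    each label.  The labels from [Q] to [Q + k - 1] are those of the matchings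
    with [e <= k]. *)
Definition cross_label i j :=
  let e := gap h i j in
  if e <= k then Q + e.-1
  else if (e == h) && ~~ odd h then Q.-1
  else h.-1./2 + (e - k.+1)./2.

Definition half_arc u v :=
  let i := pos u in let j := pos v in
  match u < h, v < h with
  | true, false => forward i j
  | false, true => ~~ forward j i
  | uA, _ => ((gap h i j).*2 < h) ||
      ((gap h i j).*2 == h) && (if uA then j < i else i < j)
  end.

Definition half_label u v :=
  let i := pos u in let j := pos v in
  match u < h, v < h with
  | true, false => cross_label i j
  | false, true => cross_label j i
  | _, _ => if (gap h i j).*2 < h then (gap h i j).-1 else Q.-1
  end.

Lemma posP u : u < h.*2 -> exists i, [/\ pos u = i, i < h &
  u < h /\ u = i \/ h <= u /\ u = i + h].
Proof.
by move=> lt_u; exists (pos u); rewrite /pos; case: (ltnP u h) => c; split; lia.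
Qed.

Definition step i j e := 0 < e /\ (i < j /\ i + e = j \/ j <= i /\ i + e = j + h).

(** The four cases are the rotational arcs inside a half, the antipodal ones,
    and the arcs between the halves in either direction. *)
Lemma half_arcP u v : u < h.*2 -> v < h.*2 -> half_arc u v ->
  exists i j e l x m, [/\ half_label u v = l, step i j e, i < h /\ j < h,
     h = 2 * x + 1 \/ h = 2 * x + 2 &
  [\/ (u = i /\ v = j \/ u = i + h /\ v = j + h) /\ 2 * e < h /\ l + 1 = e,
      (u = i /\ v = j /\ j < i \/ u = i + h /\ v = j + h /\ i < j) /\
        2 * e = h /\ l + 1 = Q,
      (u = i /\ v = j + h) /\
      (e <= k /\ l + 1 = Q + e \/ h = 2 * x + 2 /\ i = j /\ 2 * i < h /\ l + 1 = Q \/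
       e = k + 1 + 2 * m /\ l = x + m /\ (e < h \/ h = 2 * x + 1)) |
      (u = j + h /\ v = i) /\
      (h = 2 * x + 2 /\ i = j /\ h <= 2 * i /\ l + 1 = Q \/
       e = k + 2 + 2 * m /\ l = x + m /\ (e < h \/ h = 2 * x + 1))]].
Proof.
move=> lu lv; have [i [pu li Hi]] := posP lu; have [j [pv lj Hj]] := posP lv.
rewrite /half_arc /half_label pu pv.
have [e ge se] := gapP li lj; have [e' ge' se'] := gapP lj li.
pose x := h.-1./2.
have hx : h = 2 * x + 1 \/ h = 2 * x + 2 by rewrite /x; lia.
have h_odd : odd h = (h == 2 * x + 1) by lia.
rewrite /forward /cross_label ge ge' -/x h_odd.
case: Hi => -[cu eu]; case: Hj => -[cv ev];
  rewrite ?cu ?cv ?[u < h]ltnNge ?[v < h]ltnNge ?cu ?cv /=.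
- case: ltnP => c /= H; exists i, j, e; eexists; exists x, ((e - k.+1)./2); split=> //.
    by apply: Or41; split; [left|lia].
  by apply: Or42; move: H; case/andP => /eqP; lia.
- move=> H; exists i, j, e; eexists; exists x, ((e - k.+1)./2).
  split=> //; apply: Or43; split; first by [].
  move: H; case: (leqP e k) => c1; first by move=> _; left; lia.
  case: ifP => c2 /= H.
    by right; left; lia.
  by right; right; lia.
- move=> H; exists j, i, e'; eexists; exists x, ((e' - k.+1)./2).
  split=> //; apply: Or44; split; first by [].
  move: H; case: (leqP e' k) => c1; first by case: ifP => //; lia.
  case: ifP => c2 /= H.
    by left; lia.
  by right; lia.
- case: ltnP => c /= H; exists i, j, e; eexists; exists x, ((e - k.+1)./2); split=> //.
    by apply: Or41; split; [right|lia].
  by apply: Or42; move: H; case/andP => /eqP; lia.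
Qed.

Lemma half_arc_out u v w : u < h.*2 -> v < h.*2 -> w < h.*2 ->
  half_arc u v -> half_arc u w -> half_label u v = half_label u w -> v = w.
Proof.
move=> lu lv lw /(half_arcP lu lv)[i [j [e [l [x [m [-> S1 L1 X1 C1]]]]]]].
move=> /(half_arcP lu lw)[i' [j' [e' [l' [x' [m' [-> S2 L2 X2 C2]]]]]]] eq_l.
subst l'; have eq_x : x' = x by lia.
subst x'; clear lu lv lw; rewrite /step in S1 S2.
have := def_Q; rewrite -!mul2n => def_Q'.
by case: C1 => -[C1 D1]; case: C2 => -[C2 D2]; lia.
Qed.

Lemma half_arc_in u v w : u < h.*2 -> v < h.*2 -> w < h.*2 ->
  half_arc v u -> half_arc w u -> half_label v u = half_label w u -> v = w.
Proof.
move=> lu lv lw /(half_arcP lv lu)[i [j [e [l [x [m [-> S1 L1 X1 C1]]]]]]].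
move=> /(half_arcP lw lu)[i' [j' [e' [l' [x' [m' [-> S2 L2 X2 C2]]]]]]] eq_l.
subst l'; have eq_x : x' = x by lia.
subst x'; clear lu lv lw; rewrite /step in S1 S2.
have := def_Q; rewrite -!mul2n => def_Q'.
by case: C1 => -[C1 D1]; case: C2 => -[C2 D2]; lia.
Qed.

Lemma half_arc_asym u v : u < h.*2 -> v < h.*2 -> half_arc u v -> ~~ half_arc v u.
Proof.
move=> lu lv /(half_arcP lu lv)[i [j [e [l [x [m [_ S1 L1 X1 C1]]]]]]].
apply/negP => /(half_arcP lv lu)[i' [j' [e' [l' [x' [m' [_ S2 L2 X2 C2]]]]]]].
have eq_x : x' = x by lia.
subst x'; clear lu lv; rewrite /step in S1 S2.
have := def_Q; rewrite -!mul2n => def_Q'.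
by case: C1 => -[C1 D1]; case: C2 => -[C2 D2]; lia.
Qed.

Lemma half_arc_total u v : u < h.*2 -> v < h.*2 -> u <> v ->
  half_arc u v || half_arc v u.
Proof.
move=> lu lv ne; have [i [pu li Hi]] := posP lu; have [j [pv lj Hj]] := posP lv.
rewrite /half_arc pu pv.
have [e -> se] := gapP li lj; have [e' -> se'] := gapP lj li.
case: (ltnP u h) => cu; case: (ltnP v h) => cv.
- by lia.
- by case: (forward i j).
- by case: (forward j i).
- by lia.
Qed.

Lemma half_label_bound u v : u < h.*2 -> v < h.*2 -> half_arc u v ->
  half_label u v < Q + ((u < h) && (h <= v)) * k.
Proof.
move=> lu lv /(half_arcP lu lv)[i [j [e [l [x [m [-> S1 L1 X1 C1]]]]]]].
have := def_Q; rewrite -!mul2n => def_Q'; rewrite /step in S1.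
case: (ltnP u h) => cu; case: (leqP h v) => cv; rewrite /= ?mul0n ?mul1n;
  by case: C1 => -[C1 D1]; lia.
Qed.
End Halves.

(** The labels are cut into groups of [k].  The last group leaves only vertices
    of the first half and enters only vertices of the second, so every vertex
    has [2 q + 1] groups in all. *)
Lemma halves_choosable h k q : odd k -> k <= h -> h.*2 = (q * k).*2 + k + 1 ->
  choosable h.*2 k q.*2.+1.
Proof.
move=> odd_k le_kh def_h; have k_gt0 : 0 < k by case: k odd_k {le_kh def_h}.
pose arc (u v : 'I_h.*2) := half_arc h k u v.
pose lab (u v : 'I_h.*2) := half_label h k (q * k) u v.
have eq_lab u v u' v' : lab u v %/ k = lab u' v' %/ k ->
    lab u v %% k = lab u' v' %% k -> lab u v = lab u' v'.
  by move=> eq_d eq_m; rewrite (divn_eq (lab u v) k) eq_d eq_m -divn_eq.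
apply: (@tournament_choosable _ _ arc (fun u v => lab u v %/ k)
  (fun u v => lab u v %% k) _ _ _ _ _ _
  (fun u => q + (u < h)) (fun u => q + (h <= u))) => //.
- by move=> u v; apply: (half_arc_asym odd_k le_kh def_h).
- by move=> u v _; rewrite ltn_mod.
- move=> u v w auv auw eq_d eq_m; apply: val_inj.
  exact: (half_arc_out odd_k le_kh def_h _ _ _ auv auw (eq_lab _ _ _ _ eq_d eq_m)).
- move=> u v w auv auw eq_d eq_m; apply: val_inj.
  exact: (half_arc_in odd_k le_kh def_h _ _ _ auv auw (eq_lab _ _ _ _ eq_d eq_m)).
- by move=> u v; rewrite -val_eqE => /eqP ne; apply: (half_arc_total odd_k le_kh def_h).
- move=> u v auv; rewrite ltn_divLR // mulnDl.
  apply: leq_trans (half_label_bound odd_k le_kh def_h _ _ auv) _ => //.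
  by rewrite leq_add2l leq_mul2r; case: (u < h); case: (h <= v); rewrite ?orbT.
- move=> u v auv; rewrite ltn_divLR // mulnDl.
  apply: leq_trans (half_label_bound odd_k le_kh def_h _ _ auv) _ => //.
  by rewrite leq_add2l leq_mul2r; case: (u < h); case: (h <= v); rewrite ?orbT.
- by move=> u; case: (ltnP u h) => _; lia.
Qed.

(** * Complete graphs with s k and s k + 1 vertices *)

Lemma choosable_le m n k s : m <= n -> choosable n k s -> choosable m k s.
Proof.
move=> le_mn ch L leL; pose f (i : 'I_m) := widen_ord le_mn i.
have inj_f : injective f by move=> i j [] /val_inj.
have preK (e : {set 'I_m}) : f @^-1: (f @: e) = e.
  by apply/setP => i; rewrite inE mem_imset.
have [//|c [cL c_deg]] := ch (fun E => L (f @^-1: E)).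
exists (fun e : {set 'I_m} => c (f @: e)); split=> [e|v a].
  by have := cL (f @: e); rewrite preK.
apply: leq_trans (c_deg (f v) a).
rewrite [X in X <= _]/colour_degree -(card_imset _ inj_f).
apply/subset_leq_card/subsetP => _ /imsetP[u /[!inE] /andP[nuv cu] ->].
by rewrite (inj_eq inj_f) nuv imsetU1 imset_set1 in cu *.
Qed.

Lemma even_choosable k s : 0 < k -> ~~ odd s -> choosable (s * k).+1 k s.
Proof.
move=> k_gt0 /even_halfK <-; rewrite -doubleMl.
exact: circulant_choosable.
Qed.

(** The condition [1 < s] is what makes a half have at least [k] vertices, as
    required for [k] disjoint matchings between the halves. *)
Lemma odd_choosable k s : odd s -> odd k -> 1 < s -> choosable (s * k).+1 k s.
Proof.
move=> odd_s odd_k s_gt1; have def_s := odd_double_half s.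
have def_n := odd_double_half (s * k).+1.
move: def_n; rewrite /= oddM odd_s odd_k add0n => def_n.
rewrite -def_n -{1 2}def_s odd_s add1n.
apply: halves_choosable => //; nia.
Qed.

Lemma multiple_choosable k s : 0 < k -> choosable (s * k) k s.
Proof.
move=> k_gt0; have [odd_s|even_s] := boolP (odd s).
  have <- : s./2.*2.+1 = s by rewrite -[RHS]odd_double_half odd_s.
  exact: blocks_choosable.
exact: choosable_le (leqnSn _) (even_choosable k_gt0 even_s).
Qed.

(** * Ramsey numbers of stars *)

Lemma edge_complete n (u v : complete_graph n) :
  ([set u; v] \in edges (complete_graph n)) = (u != v).
Proof.
apply/imset2P/idP => [[x y _ /[!inE] /= nxy]|nuv].
  by case/pair_setP => -[-> ->]; rewrite // eq_sym.
by exists u v; rewrite ?inE.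
Qed.

Lemma monochromatic_starP n r (c : {set complete_graph n} -> nat) :
  monochromatic_copy (star r) c <-> exists v a, r <= colour_degree c v a.
Proof.
split=> [[f [a [inj_f hom_f f_a]]]|[v [a le_r]]].
  exists (f (inl ord0)), a; rewrite -[r in r <= _]card_ord.
  rewrite -(card_imset predT (_ : injective (fun i : 'I_r => f (inr i)))).
    apply/subset_leq_card/subsetP => _ /imsetP[i _ ->].
    by rewrite inE f_a // eqxx andbT (inj_eq inj_f).
  by move=> i j /inj_f[].
pose S := [set u | (u != v) && (c [set v; u] == a)].
pose f (x : 'I_1 + 'I_r) : 'I_n :=
  if x is inr i then enum_val (widen_ord (le_r : r <= #|S|) i) else v.
have fS i : (f (inr i) != v) && (c [set v; f (inr i)] == a).
  by have := enum_valP (widen_ord (le_r : r <= #|S|) i); rewrite inE.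
exists f, a; split.
- move=> [i|i] [j|j]; rewrite ?[i]ord1 ?[j]ord1 //.
  + by move/esym/eqP; have /andP[/negPf->] := fS j.
  + by move/eqP; have /andP[/negPf->] := fS i.
  + by move/enum_val_inj => [] /val_inj ->.
- move=> [i|i] [j|j] //= _; last by have /andP[] := fS i.
  by rewrite eq_sym; have /andP[] := fS j.
- move=> [i|i] [j|j] //= _; first by have /andP[_ /eqP] := fS j.
  by rewrite setUC; have /andP[_ /eqP] := fS i.
Qed.

Lemma card_palette k : #|` [fset i in iota 1 k]|%fset = k.
Proof. by rewrite card_fseq undup_id ?iota_uniq // size_iota. Qed.

Lemma choosable_not_list_ramsey n k s :
  choosable n k s -> ~ list_ramsey_at (star s.+1) k n.
Proof.
move=> ch [L [cardL monoL]].
pose L' e := if e \in edges (complete_graph n) then L e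
             else [fset i in iota 1 k]%fset.
have [e|c [cL c_deg]] := ch L'.
  by rewrite /L'; case: ifP => [/cardL ->|_]; rewrite ?card_palette.
have /monochromatic_starP[v [a]] :
    @monochromatic_copy (star s.+1) (complete_graph n) c.
  by apply: monoL => e edge_e; have := cL e; rewrite /L' edge_e.
by rewrite ltnNge c_deg.
Qed.

(** The handshake lemma for the graph formed by one colour class. *)
Lemma colour_degree_even n (c : {set 'I_n} -> nat) a :
  ~~ odd (\sum_v colour_degree c v a).
Proof.
pose P (v u : 'I_n) := (u != v) && (c [set v; u] == a).
have PC v u : P v u = P u v by rewrite /P eq_sym setUC.
have -> : \sum_v colour_degree c v a =
    \sum_(v < n) \sum_(u < n) ((u < v) && P v u : nat) +
    \sum_(v < n) \sum_(u < n) ((v < u) && P v u : nat).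
  rewrite -big_split; apply: eq_bigr => v _; rewrite -big_split /colour_degree.
  rewrite -sum1_card big_mkcond; apply: eq_bigr => u _; rewrite inE -/(P v u).
  case Pvu: (P v u); rewrite ?andbF ?andbT //.
  by case/andP: Pvu => nuv _; move: nuv; rewrite -val_eqE /=; case: ltngtP.
rewrite [X in _ + X]exchange_big /=.
under [X in _ + X]eq_bigr do under eq_bigr do rewrite PC.
by rewrite addnn odd_double.
Qed.

Lemma sum_colour_degree n k (c : {set complete_graph n} -> nat) (v : 'I_n) :
    list_colouring (fun=> [fset i in iota 1 k]%fset) c ->
  \sum_(a < k) colour_degree c v a.+1 = n.-1.
Proof.
move=> cL; transitivity #|[set u : 'I_n | u != v]|; last first.
  by rewrite cardsE cardC1 card_ord.
rewrite -sum1_card.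
have c_range u : u != v -> 0 < c [set v; u] <= k.
  move=> nuv; have := cL [set v; u]; rewrite edge_complete eq_sym nuv => /(_ isT).
  by rewrite !inE mem_iota; lia.
have [k0|k_gt0] := posnP k; first subst k.
  rewrite big_ord0 big_pred0 // => u; rewrite inE; apply/negbTE/negP => /c_range; lia.
case: k k_gt0 c_range {cL} => // k _ c_range.
rewrite (partition_big (fun u => inord (c [set v; u]).-1 : 'I_k.+1) predT) //=.
apply: eq_bigr => a _; rewrite /colour_degree -sum1_card; apply: eq_bigl => u.
rewrite !inE; case: eqP => //= /eqP nuv; have := c_range u nuv => c_uv.
by rewrite -val_eqE /= inordK; [apply/eqP/eqP|]; lia.
Qed.

Lemma colour_degree_pigeonhole n k s (c : {set complete_graph n} -> nat) :
    list_colouring (fun=> [fset i in iota 1 k]%fset) c ->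
    ~ monochromatic_copy (star s.+1) c ->
  forall v : 'I_n, n.-1 <= s * k ?= iff
    [forall a : 'I_k, colour_degree c v a.+1 == s].
Proof.
move=> cL no_mono v; rewrite -(sum_colour_degree v cL).
rewrite mulnC -[k in k * s]card_ord -sum_nat_const.
apply: leqif_sum => a _; split=> //; rewrite leqNgt; apply/negP => lt_s.
by apply: no_mono; apply/monochromatic_starP; exists v, a.+1.
Qed.

Lemma ramsey_star_le k s : ramsey_at (star s.+1) k (s * k).+2.
Proof.
move=> c cL; apply: contrapT => no_mono.
by have [] := colour_degree_pigeonhole cL no_mono ord0; rewrite ltnn.
Qed.

(** By equality in the pigeonhole bound, each colour would form an [s]-regular
    graph, with [s] and the number of vertices both odd. *)
Lemma ramsey_star_even_le k s : 0 < k -> ~~ odd k -> odd s ->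
  ramsey_at (star s.+1) k (s * k).+1.
Proof.
move=> k_gt0 even_k odd_s c cL; apply: contrapT => no_mono.
have deg1 (v : 'I_(s * k).+1) : colour_degree c v 1 = s.
  have [_ /esym] := colour_degree_pigeonhole cL no_mono v; rewrite eqxx.
  by move/forallP/(_ (Ordinal k_gt0))/eqP.
have := colour_degree_even c 1.
under eq_bigr do rewrite deg1.
by rewrite sum_nat_const card_ord oddM /= oddM odd_s (negPf even_k).
Qed.

Lemma least_eq (P : nat -> Prop) N :
  P N -> (forall m, m < N -> ~ P m) -> least P = N.
Proof.
move=> PN minN; have [Pl le_l] := @leastP P (ex_intro _ N PN).
apply/eqP; rewrite eqn_leq le_l // leqNgt; apply/negP => lt_l.
exact: minN lt_l Pl.
Qed.

Lemma list_ramsey_of_ramsey G k n : ramsey_at G k n -> list_ramsey_at G k n.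
Proof.
move=> ramsey_n; exists (fun=> [fset i in iota 1 k]%fset); split=> // e _.
exact: card_palette.
Qed.

Lemma choosable_ramsey_eq k s n : choosable n k s -> ramsey_at (star s.+1) k n.+1 ->
  list_ramsey (star s.+1) k = n.+1 /\ ramsey (star s.+1) k = n.+1.
Proof.
move=> ch ramsey_n.
have not_list m : m < n.+1 -> ~ list_ramsey_at (star s.+1) k m.
  by move=> lt_m; apply: choosable_not_list_ramsey; apply: choosable_le ch.
split; apply: least_eq => //; first exact: list_ramsey_of_ramsey.
by move=> m /not_list not_m /list_ramsey_of_ramsey.
Qed.

Lemma list_ramsey_star_ge k s : 0 < k ->
  (s * k).+1 <= list_ramsey (star s.+1) k.
Proof.
move=> k_gt0; rewrite ltnNge; apply/negP => le_l.
have [|at_l _] := @leastP (list_ramsey_at (star s.+1) k).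
  by exists (s * k).+2; apply/list_ramsey_of_ramsey/ramsey_star_le.
apply: choosable_not_list_ramsey at_l.
exact: choosable_le le_l (@multiple_choosable k s k_gt0).
Qed.

Lemma ramsey_star_both_even k s : 0 < k -> ~~ odd k -> odd s ->
  list_ramsey (star s.+1) k = (s * k).+1 /\ ramsey (star s.+1) k = (s * k).+1.
Proof.
move=> k_gt0 even_k odd_s; apply: choosable_ramsey_eq.
  exact: multiple_choosable.
exact: ramsey_star_even_le.
Qed.

Lemma ramsey_star_not_both_even k s : 0 < k -> ~~ odd s || odd k && (1 < s) ->
  list_ramsey (star s.+1) k = (s * k).+2 /\ ramsey (star s.+1) k = (s * k).+2.
Proof.
move=> k_gt0 sk; apply: choosable_ramsey_eq; last exact: ramsey_star_le.
have [odd_s|even_s] := boolP (odd s); last exact: even_choosable.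
by move: sk; rewrite odd_s => /andP[odd_k s_gt1]; apply: odd_choosable.
Qed.

(** * The theorem *)

Theorem theorem1 :
  (* the two Ramsey numbers agree: always for even k, and for all but finitely
     many r for odd k *)
  ((forall k r : nat, 0 < k -> 0 < r -> ~~ odd k ->
      list_ramsey (star r) k = ramsey (star r) k) /\
   (forall k : nat, 0 < k -> odd k ->
      exists S : {fset nat}, forall r : nat, 0 < r -> r \notin S ->
        list_ramsey (star r) k = ramsey (star r) k)) /\
  (* (a) *)
  ((forall r k : nat, 0 < r -> 0 < k ->
      (r - 1) * k + 1 <= list_ramsey (star r) k) /\
   (forall r k : nat, 0 < r -> 0 < k -> ~~ odd r -> ~~ odd k ->
      list_ramsey (star r) k = (r - 1) * k + 1 /\
      (r - 1) * k + 1 = ramsey (star r) k)) /\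
  (* (b) *)
  (exists w : nat -> nat,
     (forall k : nat, 0 < k -> 0 < w k) /\
     (forall k r : nat, 0 < k -> w k <= r -> ~ (~~ odd r /\ ~~ odd k) ->
        list_ramsey (star r) k = (r - 1) * k + 2 /\
        (r - 1) * k + 2 = ramsey (star r) k)).
Proof.
split; [split|split; [split|]].
- move=> k [//|s] k_gt0 _ even_k; have [odd_s|even_s] := boolP (odd s).
    by have [-> ->] := ramsey_star_both_even k_gt0 even_k odd_s.
  by have [|-> ->] := @ramsey_star_not_both_even k s k_gt0; rewrite ?even_s.
(* Only r = 2 with k odd is covered by neither of the two lemmas above. *)
- move=> k k_gt0 odd_k; exists [fset 2]%fset => -[//|s] _; rewrite inE => s_neq1.
  have [|-> -> //] := @ramsey_star_not_both_even k s k_gt0.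
  by rewrite odd_k; case: s s_neq1 => [|[|s]] // _; rewrite orbT.
- move=> [//|s] k _ k_gt0; rewrite subn1 addn1.
  exact: list_ramsey_star_ge.
- move=> [//|s] k _ k_gt0 /= /negbNE odd_s even_k; rewrite subn1 addn1.
  by have [-> ->] := ramsey_star_both_even k_gt0 even_k odd_s.
exists (fun=> 3); split=> // k [//|s] k_gt0 s_gt1 not_even; rewrite subn1 addn2.
have [|-> -> //] := @ramsey_star_not_both_even k s k_gt0.
rewrite (s_gt1 : 1 < s) andbT; apply/orP.
have [odd_s|] := boolP (odd s); last by left.
by right; apply/negPn/negP => even_k; apply: not_even; rewrite /= odd_s.
Qed.
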